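(* For any group $\Gamma$, the categories $\mathbf{POG}_\Gamma$, $\mathbf{OG}_\Gamma$, $\mathbf{POG}^u_\Gamma$, $\mathbf{OG}^u_\Gamma$, $\mathbf{POG}^D_\Gamma$, and $\mathbf{OG}^D_\Gamma$ are closed under the formation of direct limits (of directed systems indexed by directed sets).
   Context: $\Gamma$ is an arbitrary group. $\mathbb Z^+[\Gamma]\subseteq\mathbb Z[\Gamma]$ is the set of elements with all coefficients nonnegative. A $\Gamma$-group is an abelian group with a left $\Gamma$-action by group automorphisms, i.e. a left $\mathbb Z[\Gamma]$-module. A pre-ordered $\Gamma$-group is a $\Gamma$-group $G$ with a reflexive transitive relation $\ge$ such that $g_1\ge g_2$ implies $g_1+h\ge g_2+h$ and $\gamma g_1\ge\gamma g_2$ for all $g_1,g_2,h\in G$, $\gamma\in\Gamma$; $G^+=\{x\in G:x\ge0\}$ is its cone. It is an ordered $\Gamma$-group if $\ge$ is a partial order. An order-unit of $G$ is $u\in G^+$ such that for every $x\in G$ there is a nonzero $a\in\mathbb Z^+[\Gamma]$ with $x\le au$. A generating interval of $G$ is a subset $D\subseteq G^+$ containing $0$ which is upwards directed (any two elements of $D$ have a common upper bound in $D$), convex ($x\le z\le y$ with $x,y\in D$, $z\in G$ implies $z\in D$), and such that every element of $G^+$ is a finite sum of elements $ad$ with $a\in\mathbb Z^+[\Gamma]$, $d\in D$. $\mathbf{POG}_\Gamma$: objects are pre-ordered $\Gamma$-groups, morphisms are order-preserving $\mathbb Z[\Gamma]$-module homomorphisms ($f(G^+)\subseteq H^+$). $\mathbf{OG}_\Gamma$: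 the full subcategory of ordered $\Gamma$-groups. $\mathbf{POG}^u_\Gamma$ (resp. $\mathbf{OG}^u_\Gamma$): objects are pairs $(G,u)$ with $G$ in $\mathbf{POG}_\Gamma$ (resp. $\mathbf{OG}_\Gamma$) and $u$ an order-unit of $G$; morphisms $(G,u)\to(H,v)$ are morphisms $f$ of $\mathbf{POG}_\Gamma$ with $f(u)=v$. $\mathbf{POG}^D_\Gamma$ (resp. $\mathbf{OG}^D_\Gamma$): objects are pairs $(G,D)$ with $G$ in $\mathbf{POG}_\Gamma$ (resp. $\mathbf{OG}_\Gamma$) and $D$ a generating interval of $G$; morphisms $(G,D)\to(H,E)$ are morphisms $f$ of $\mathbf{POG}_\Gamma$ with $f(D)\subseteq E$. *)

(* Defs.v *)
From HB Require Import structures.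
From mathcomp Require Import all_boot all_algebra.
From mathcomp Require Import finmap.
From mathcomp Require Import boolp classical_sets.
From mathcomp.multinomials Require Import monalg.

Set Implicit Arguments.
Unset Strict Implicit.
Unset Printing Implicit Defensive.

Import GRing.Theory.
Local Open Scope classical_set_scope.
Local Open Scope ring_scope.

Record category := Category {
  cat_obj :> Type;
  cat_hom : cat_obj -> cat_obj -> Type;
  cat_id : forall x, cat_hom x x;
  cat_comp : forall x y z, cat_hom y z -> cat_hom x y -> cat_hom x z;
  cat_comp_idl : forall x y (f : cat_hom x y), cat_comp (cat_id y) f = f;
  cat_comp_idr : forall x y (f : cat_hom x y), cat_comp f (cat_id x) = f;
  cat_comp_assoc :
    forall x y z t (h : cat_hom z t) (g : cat_hom y z) (f : cat_hom x y),
    cat_comp h (cat_comp g f) = cat_comp (cat_comp h g) f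
}.
Arguments cat_hom {c}.
Arguments cat_id {c}.
Arguments cat_comp {c x y z}.

Definition full_subcategory (C : category) (P : C -> Prop) : category :=
  @Category {x : C | P x}
    (fun x y => cat_hom (sval x) (sval y))
    (fun x => cat_id (sval x))
    (fun x y z g f => cat_comp g f)
    (fun x y f => cat_comp_idl f)
    (fun x y f => cat_comp_idr f)
    (fun x y z t h g f => cat_comp_assoc h g f).

(* Objects of C with extra structure; the morphisms are those of C that
   preserve this structure. *)
Section StructuredCategory.
Variables (C : category) (T : Type) (F : T -> C).
Variable P : forall x y : T, cat_hom (F x) (F y) -> Prop.
Hypothesis Pid : forall x, P (cat_id (F x)).
Hypothesis Pcomp :
  forall x y z (g : cat_hom (F y) (F z)) (f : cat_hom (F x) (F y)),
  P g -> P f -> P (cat_comp g f).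

Let shom x y := {f : cat_hom (F x) (F y) | P f}.
Let sid x : shom x x := exist _ (cat_id (F x)) (Pid x).
Let scomp x y z (g : shom y z) (f : shom x y) : shom x z :=
  exist _ (cat_comp (sval g) (sval f)) (Pcomp (svalP g) (svalP f)).

Lemma shom_eq x y (f g : shom x y) : sval f = sval g -> f = g.
Proof. by case: f g => [f Pf] [g Pg] /= e; apply: eq_exist. Qed.

Definition structured_category : category.
Proof.
apply: (@Category T shom sid scomp) => [x y f|x y f|x y z t h g f];
  apply: shom_eq.
- exact: cat_comp_idl.
- exact: cat_comp_idr.
- exact: cat_comp_assoc.
Defined.
End StructuredCategory.

Record directed_set := DirectedSet {
  dset :> Type;
  dle : dset -> dset -> Prop;
  dle_refl : forall i, dle i i;
  dle_trans : forall i j k, dle i j -> dle j k -> dle i k;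
  dset_inhabited : inhabited dset;
  dset_directed : forall i j, exists k, dle i k /\ dle j k
}.

Record directed_system (C : category) (I : directed_set) := DirectedSystem {
  sys_obj :> I -> C;
  sys_map : forall i j, dle i j -> cat_hom (sys_obj i) (sys_obj j);
  sys_map_id : forall i (hii : dle i i), sys_map hii = cat_id (sys_obj i);
  sys_map_comp : forall i j k (hij : dle i j) (hjk : dle j k) (hik : dle i k),
    cat_comp (sys_map hjk) (sys_map hij) = sys_map hik
}.

Record cocone (C : category) (I : directed_set) (S : directed_system C I) :=
  Cocone {
    vertex : C;
    leg : forall i, cat_hom (S i) vertex;
    leg_compat : forall i j (hij : dle i j),
      cat_comp (leg j) (sys_map S hij) = leg i
  }.

Definition is_direct_limit (C : category) (I : directed_set)
    (S : directed_system C I) (L : cocone S) : Prop :=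
  forall K : cocone S, exists! f : cat_hom (vertex L) (vertex K),
    forall i, cat_comp f (leg L i) = leg K i.

Definition has_direct_limits (C : category) : Prop :=
  forall (I : directed_set) (S : directed_system C I),
    exists L : cocone S, is_direct_limit L.

(* Closure of the full subcategory of C on P. This is not implied by the
   existence of direct limits in full_subcategory P (which could differ from
   those in C, as in a reflective subcategory). *)
Definition stable_under_direct_limits (C : category) (P : C -> Prop) : Prop :=
  forall (I : directed_set) (S : directed_system C I) (L : cocone S),
    (forall i, P (S i)) -> is_direct_limit L -> P (vertex L).

Record gammaGroup (Gamma : groupType) := GammaGroup {
  gcarrier :> zmodType;
  gact : Gamma -> gcarrier -> gcarrier;
  gact1 : forall x, gact 1%g x = x;
  gactM : forall a b x, gact (a * b)%g x = gact a (gact b x);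
  gactD : forall a x y, gact a (x + y) = gact a x + gact a y
}.

(* The left action of the group ring Z[Gamma], whose underlying abelian group
   is {malg int[Gamma]}. (The ring structure on malg is not available here: it
   requires a monomType, which excludes nontrivial groups.) *)
Definition zact (Gamma : groupType) (G : gammaGroup Gamma)
    (a : {malg int[Gamma]}) (x : G) : G :=
  \sum_(g <- msupp a) gact g x *~ a@_g.

Definition zpos (Gamma : groupType) (a : {malg int[Gamma]}) : Prop :=
  forall g, 0 <= a@_g.

Record preorderedGroup (Gamma : groupType) := PreorderedGroup {
  pog_group :> gammaGroup Gamma;
  pge : pog_group -> pog_group -> Prop;
  pge_refl : forall x, pge x x;
  pge_trans : forall x y z, pge x y -> pge y z -> pge x z;
  pge_add : forall x y h, pge x y -> pge (x + h) (y + h);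
  pge_act : forall (c : Gamma) x y, pge x y -> pge (gact c x) (gact c y)
}.

Section PreorderedGroups.
Variable Gamma : groupType.
Implicit Types G H : preorderedGroup Gamma.

Definition pos_cone G : set G := [set x | pge x 0].

Definition is_ordered G : Prop :=
  forall x y : G, pge x y -> pge y x -> x = y.

Definition order_unit G (u : G) : Prop :=
  pos_cone u /\
  forall x : G, exists a : {malg int[Gamma]},
    [/\ zpos a, a <> 0 & pge (zact a u) x].

Definition generating_interval G (D : set G) : Prop :=
  [/\ D `<=` @pos_cone G,
      D 0,
      forall x y, D x -> D y -> exists z, [/\ D z, pge z x & pge z y],
      forall x z y, D x -> D y -> pge z x -> pge y z -> D z
    & forall x, pos_cone x -> exists s : seq ({malg int[Gamma]} * G),
        (forall p, p \in s -> zpos p.1 /\ D p.2) /\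
        x = \sum_(p <- s) zact p.1 p.2].

Record pog_hom G H := PogHom {
  pog_fun :> G -> H;
  pog_funD : forall x y, pog_fun (x + y) = pog_fun x + pog_fun y;
  pog_fun_act : forall (c : Gamma) x, pog_fun (gact c x) = gact c (pog_fun x);
  pog_fun_cone : forall x, pos_cone x -> pos_cone (pog_fun x)
}.

Lemma pog_hom_eq G H (f g : pog_hom G H) : (forall x, f x = g x) -> f = g.
Proof.
case: f g => [f fD fa fc] [g gD ga gc] /= /funext e.
rewrite {}e in fD fa fc *.
by rewrite (Prop_irrelevance fD gD) (Prop_irrelevance fa ga)
  (Prop_irrelevance fc gc).
Qed.

Definition pog_id G : pog_hom G G :=
  @PogHom G G id (fun _ _ => erefl) (fun _ _ => erefl) (fun _ h => h).

Definition pog_comp G H K (g : pog_hom H K) (f : pog_hom G H) : pog_hom G K.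
Proof.
apply: (@PogHom G K (g \o f)) => [x y|c x|x hx] /=.
- by rewrite !pog_funD.
- by rewrite !pog_fun_act.
- exact/pog_fun_cone/pog_fun_cone.
Defined.

Definition POG : category.
Proof.
by apply: (@Category (preorderedGroup Gamma) pog_hom pog_id pog_comp) => *;
  exact: pog_hom_eq.
Defined.

Record unitGroup := UnitGroup {
  ug_group : POG;
  ug_unit : ug_group;
  ug_unitP : order_unit ug_unit
}.

Definition POGu : category :=
  @structured_category POG unitGroup ug_group
    (fun (X Y : unitGroup) (f : pog_hom _ _) => f (ug_unit X) = ug_unit Y)
    (fun X => erefl)
    (fun X Y Z g f hg hf => etrans (congr1 (pog_fun g) hf) hg).

Record intervalGroup := IntervalGroup {
  ig_group : POG;
  ig_set : set ig_group;
  ig_setP : generating_interval ig_set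
}.
Arguments ig_set : clear implicits.

Definition POGD : category.
Proof.
apply: (@structured_category POG intervalGroup ig_group
  (fun X Y (f : pog_hom _ _) => f @` ig_set X `<=` ig_set Y)).
- by move=> X _ [x hx <-].
- move=> X Y Z g f hg hf _ [x hx <-] /=.
  by apply: hg; exists (f x) => //; apply: hf; exists x.
Defined.

Definition OG : category := @full_subcategory POG is_ordered.
Definition OGu : category :=
  @full_subcategory POGu (fun X => is_ordered (ug_group X)).
Definition OGD : category :=
  @full_subcategory POGD (fun X => is_ordered (ig_group X)).

End PreorderedGroups.

(* Main.v *)
Require Import Defs.
From HB Require Import structures.
From mathcomp Require Import all_boot all_algebra.
From mathcomp Require Import boolp classical_sets.
From mathcomp.multinomials Require Import monalg.

Set Implicit Arguments.
Unset Strict Implicit.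
Unset Printing Implicit Defensive.

Import GRing.Theory.
Local Open Scope quotient_scope.
Local Open Scope ring_scope.

(** The direct limit of a directed system of pre-ordered [Gamma]-groups is the
    usual one of abelian groups: germs [(i, a)] with [a] in the [i]-th group,
    two germs being identified when they agree at some later stage. Since the
    index set is directed, any finite family of elements lives at a common
    stage, and any finite number of equalities and inequalities between
    elements given at one stage already holds at some later stage
    ([inj_eq2], [colim_ge_inj2]). Hence every axiom about finitely many elements
    passes to the limit. This gives the [Gamma]-group structure, the
    pre-order (an inequality holds in the limit when it holds at some stage)
    and also antisymmetry, if every term of the system is ordered
    ([colim_is_ordered]).

    The additional data are transported by the injections [inj]. The images of
    the order-units [u_i] all coincide, and the common value dominates every
    element because each element comes from some stage ([colim_order_unit]).
    The union of the images of the generating intervals [D_i] is a generating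
    interval, again because each condition concerns finitely many elements
    ([colim_generating_interval]). The distinguished unit or interval of the
    limit consists of images of those of the terms, so a map out of the limit
    preserves it as soon as its composites with the injections do; hence the
    universal property lifts from pre-ordered groups to structured ones
    ([structured_direct_limit]).

    Finally, direct limits are unique up to isomorphism, so an arbitrary direct
    limit of ordered groups is a retract of the one constructed here, hence
    ordered ([stable_of_limits], [is_ordered_retract]); and a direct limit that
    remains in a full subcategory is a direct limit there
    ([full_subcategory_limits]). *)

(** * Direct limits in full and structured subcategories *)

(** What an explicit construction provides: each system has one direct limit
    that inherits [P] from the terms. The other direct limits of the same system
    are handled by [stable_of_limits]. *)
Definition has_direct_limits_with (C : category) (P : C -> Prop) : Prop :=
  forall (I : directed_set) (S : directed_system C I),
    exists L : cocone S,
      is_direct_limit L /\ ((forall i, P (S i)) -> P (vertex L)).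

Lemma has_direct_limits_withW (C : category) (P : C -> Prop) :
  has_direct_limits_with P -> has_direct_limits C.
Proof. by move=> hC I S; have [L [hL _]] := hC I S; exists L. Qed.

(** The comparison maps between two direct limits are mutually inverse, so it
    is enough that [P] descend along split monomorphisms. *)
Lemma stable_of_limits (C : category) (P : C -> Prop) :
  (forall (x y : C) (f : cat_hom x y) (g : cat_hom y x),
     cat_comp g f = cat_id x -> P y -> P x) ->
  has_direct_limits_with P -> stable_under_direct_limits P.
Proof.
move=> Pretract hC I S L PS hL; have [L' [hL' /(_ PS) PL']] := hC I S.
have [f [fE _]] := hL L'; have [g [gE _]] := hL' L.
apply: (Pretract _ _ f g) PL'.
have [k [_ kuniq]] := hL L.
rewrite -(kuniq (cat_comp g f)); last first.
  by move=> i; rewrite -cat_comp_assoc fE gE.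
by apply: kuniq => i; rewrite cat_comp_idl.
Qed.

Section FullSubcategory.
Variables (C : category) (P : C -> Prop).
Let D := full_subcategory P.

Definition underlying_full_system I (S : directed_system D I) :
    directed_system C I :=
  @DirectedSystem C I (fun i => sval (S i)) (sys_map S)
    (sys_map_id S) (sys_map_comp S).

Definition underlying_full_cocone I (S : directed_system D I) (K : cocone S) :
    cocone (underlying_full_system S) :=
  @Cocone C I (underlying_full_system S) (sval (vertex K)) (leg K)
    (leg_compat K).

(** Morphisms and cocones of the full subcategory are those of [C], so a direct
    limit in [C] with vertex in [P] has the same universal property there. *)
Lemma full_subcategory_limits :
  has_direct_limits_with P -> has_direct_limits D.
Proof.
move=> hC I S; have [[x l lE] [hL PL]] := hC I (underlying_full_system S).
have Px : P x by apply: PL => i; exact: (svalP (S i)).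
exists (@Cocone D I S (exist _ x Px) l lE) => K.
exact: (hL (underlying_full_cocone K)).
Qed.

End FullSubcategory.

Section Structured.
Variables (C : category) (T : Type) (F : T -> C).
Variable P : forall x y : T, cat_hom (F x) (F y) -> Prop.
Hypothesis Pid : forall x, P (cat_id (F x)).
Hypothesis Pcomp :
  forall x y z (g : cat_hom (F y) (F z)) (f : cat_hom (F x) (F y)),
  P g -> P f -> P (cat_comp g f).
Let D := structured_category Pid Pcomp.

Definition underlying_system I (S : directed_system D I) :
  directed_system C I.
Proof.
apply: (@DirectedSystem C I (fun i => F (S i))
  (fun i j hij => sval (sys_map S hij))) => [i hii|i j k hij hjk hik].
- by rewrite sys_map_id.
- by rewrite -(sys_map_comp S hij hjk hik).
Defined.

Definition underlying_cocone I (S : directed_system D I) (K : cocone S) :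
  cocone (underlying_system S).
Proof.
apply: (@Cocone C I (underlying_system S) (F (vertex K))
  (fun i => sval (leg K i))) => i j hij.
by rewrite -(leg_compat K hij).
Defined.

(** A direct limit in [C] lifts once its vertex carries a structure that the
    legs preserve and that is final for them: a map out of the vertex preserves
    the structure as soon as its composites with the legs do. *)
Lemma structured_direct_limit I (S : directed_system D I) (X : T)
    (l : forall i, cat_hom (F (S i)) (F X))
    (lE : forall i j (hij : dle i j),
       cat_comp (l j) (sys_map (underlying_system S) hij) = l i) :
  is_direct_limit (@Cocone C I (underlying_system S) (F X) l lE) ->
  (forall i, P (l i)) ->
  (forall (Y : T) (f : cat_hom (F X) (F Y)),
     (forall i, P (cat_comp f (l i))) -> P f) ->
  exists2 L : cocone S, is_direct_limit L & vertex L = X.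
Proof.
move=> hL Pl Pfinal.
pose l' i : @cat_hom D (S i) X := exist _ (l i) (Pl i).
have l'E i j (hij : dle i j) : cat_comp (l' j) (sys_map S hij) = l' i.
  by apply: shom_eq; exact: lE.
exists (Cocone l'E) => // K.
have [f [fE funiq]] := hL (underlying_cocone K).
have Pf : P f by apply: Pfinal => i; rewrite fE; exact: (svalP (leg K i)).
exists (exist _ f Pf); split=> [i|g gE]; apply: shom_eq.
- exact: fE.
- by apply: funiq => i /=; rewrite -gE.
Qed.

End Structured.

(** * Order and group-ring action under morphisms *)

Section Morphisms.
Variable Gamma : groupType.
Implicit Types G H : preorderedGroup Gamma.

Lemma pge_subr0 G (x y : G) : pge x y <-> pge (x - y) 0.
Proof.
split=> [/(pge_add (- y))|/(pge_add y)]; first by rewrite subrr.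
by rewrite subrK add0r.
Qed.

Section OneMorphism.
Variables (G H : preorderedGroup Gamma) (f : pog_hom G H).

Lemma pog_fun0 : f 0 = 0.
Proof. by apply: (addIr (f 0)); rewrite -pog_funD !add0r. Qed.

Lemma pog_funN x : f (- x) = - f x.
Proof. by apply: (addIr (f x)); rewrite -pog_funD !addNr pog_fun0. Qed.

Lemma pog_fun_ge x y : pge x y -> pge (f x) (f y).
Proof.
move=> /pge_subr0 /(pog_fun_cone f) xy; apply/pge_subr0.
by rewrite -pog_funN -pog_funD.
Qed.

Lemma pog_fun_sum T (s : seq T) (F : T -> G) :
  f (\sum_(t <- s) F t) = \sum_(t <- s) f (F t).
Proof. exact: (big_morph f (@pog_funD _ _ _ f) pog_fun0). Qed.

Lemma pog_fun_zact a x : f (zact a x) = zact a (f x).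
Proof.
have fMn n y : f (y *+ n) = f y *+ n.
  by elim: n => [|n IHn]; rewrite ?mulr0n ?pog_fun0 // !mulrS pog_funD IHn.
rewrite /zact pog_fun_sum; apply: eq_bigr => g _.
rewrite -pog_fun_act; case: (a@_g) => n; first exact: fMn.
by rewrite !NegzE !mulrNz pog_funN fMn.
Qed.

End OneMorphism.

(** Morphisms only preserve inequalities, and this suffices: antisymmetry turns
    a pair of opposite inequalities between images into an equality, which
    injectivity reflects. *)
Lemma is_ordered_inj G H (f : pog_hom G H) :
  injective f -> is_ordered H -> is_ordered G.
Proof.
by move=> finj oH x y xy yx; apply/finj/oH; exact: pog_fun_ge.
Qed.

Lemma is_ordered_retract G H (f : pog_hom G H) (g : pog_hom H G) :
  pog_comp g f = pog_id G -> is_ordered H -> is_ordered G.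
Proof.
move=> gf; apply: (@is_ordered_inj _ _ f); apply: (can_inj (g := g)) => x.
exact: (congr1 (fun h : pog_hom G G => h x) gf).
Qed.

End Morphisms.

(** * The direct limit of pre-ordered groups *)

Section Colimit.
Variables (Gamma : groupType) (I : directed_set).
Variable G : I -> preorderedGroup Gamma.
Variable phi : forall i j, dle i j -> pog_hom (G i) (G j).
Hypothesis phi_id : forall i (h : dle i i) x, phi h x = x.
Hypothesis phi_comp :
  forall i j k (hij : dle i j) (hjk : dle j k) (hik : dle i k) x,
  phi hjk (phi hij x) = phi hik x.

Definition germ : Type := {i : I & G i}.
HB.instance Definition _ := gen_eqMixin germ.
HB.instance Definition _ := gen_choiceMixin germ.

Definition germ_eq (x y : germ) : bool :=
  `[< exists k (hx : dle (tag x) k) (hy : dle (tag y) k),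
        phi hx (tagged x) = phi hy (tagged y) >].

Lemma germ_eq_refl : reflexive germ_eq.
Proof.
by move=> x; apply/asboolP; exists (tag x), (dle_refl _), (dle_refl _).
Qed.

Lemma germ_eq_sym : symmetric germ_eq.
Proof.
move=> x y; apply/asboolP/asboolP => -[k [hx [hy e]]]; by exists k, hy, hx.
Qed.

Lemma germ_eq_trans : transitive germ_eq.
Proof.
move=> y x z /asboolP[k [hx [hy exy]]] /asboolP[l [hy' [hz eyz]]].
have [m [hkm hlm]] := dset_directed k l.
apply/asboolP; exists m, (dle_trans hx hkm), (dle_trans hz hlm).
rewrite -(phi_comp hx hkm) exy -(phi_comp hz hlm) -eyz.
by rewrite !(phi_comp _ _ (dle_trans hy hkm)).
Qed.

Canonical germ_equiv := EquivRel germ_eq germ_eq_refl germ_eq_sym germ_eq_trans.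

Definition colim : Type := {eq_quot germ_equiv}.
HB.instance Definition _ := Choice.on colim.

Definition inj i (a : G i) : colim :=
  \pi_({eq_quot germ_equiv}) (Tagged (fun i => gcarrier (G i)) a).

Lemma inj_eq i j (a : G i) (b : G j) :
  inj a = inj b <->
  exists k (hi : dle i k) (hj : dle j k), phi hi a = phi hj b.
Proof. by split=> [/eqmodP/asboolP|e]; last by apply/eqmodP/asboolP. Qed.

Lemma inj_phi i j (h : dle i j) (a : G i) : inj (phi h a) = inj a.
Proof.
by apply/inj_eq; exists j, (dle_refl j), h; exact: phi_id.
Qed.

Lemma colim_ind1 (x : colim) : exists i (a : G i), x = inj a.
Proof.
exists (tag (repr x)), (tagged (repr x)).
by rewrite -[LHS]reprK /inj; case: (repr x).
Qed.

Lemma colim_ind2 (x y : colim) :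
  exists i (a b : G i), x = inj a /\ y = inj b.
Proof.
have [i [a ->]] := colim_ind1 x; have [j [b ->]] := colim_ind1 y.
have [k [hi hj]] := dset_directed i j.
by exists k, (phi hi a), (phi hj b); rewrite !inj_phi.
Qed.

Lemma colim_ind3 (x y z : colim) :
  exists i (a b c : G i), [/\ x = inj a, y = inj b & z = inj c].
Proof.
have [i [a [b [-> ->]]]] := colim_ind2 x y; have [j [c ->]] := colim_ind1 z.
have [k [hi hj]] := dset_directed i j.
by exists k, (phi hi a), (phi hi b), (phi hj c); rewrite !inj_phi.
Qed.

(** Two coincidences in the limit are realised at one and the same stage; this
    is what makes binary operations and relations well defined. *)
Lemma inj_eq2 i j (a b : G i) (c d : G j) :
  inj a = inj c -> inj b = inj d ->
  exists k (hi : dle i k) (hj : dle j k),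
    phi hi a = phi hj c /\ phi hi b = phi hj d.
Proof.
move=> /inj_eq[k [hi [hj ac]]] /inj_eq[l [hi' [hj' bd]]].
have [m [hk hl]] := dset_directed k l.
exists m, (dle_trans hi hk), (dle_trans hj hk).
rewrite -(phi_comp hi hk) ac (phi_comp hj hk (dle_trans hj hk)); split=> //.
by rewrite -(phi_comp hi' hl) bd (phi_comp hj' hl (dle_trans hj hk)).
Qed.

(** A map out of the limit, given by its value on chosen representatives; it is
    meaningful for the compatible families of [desc_inj]. *)
Definition desc (Y : Type) (f : forall i, G i -> Y) (x : colim) : Y :=
  f (tag (repr x)) (tagged (repr x)).

Lemma desc_inj (Y : Type) (f : forall i, G i -> Y) :
  (forall i j (h : dle i j) a, f j (phi h a) = f i a) ->
  forall i (a : G i), desc f (inj a) = f i a.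
Proof.
move=> fE i a; rewrite /desc.
have /inj_eq[k [h [h' e]]] : inj (tagged (repr (inj a))) = inj a.
  by rewrite -[RHS]reprK /inj; case: (repr _).
by rewrite -(fE _ _ h) e fE.
Qed.

(** Addition is defined from this by choice, so that it needs no preferred
    upper bound of two stages. *)
Lemma colim_add_exists (x y : colim) : exists z : colim,
  exists i (a b : G i), [/\ x = inj a, y = inj b & z = inj (a + b)].
Proof.
by have [i [a [b [-> ->]]]] := colim_ind2 x y; exists (inj (a + b)), i, a, b.
Qed.

Definition colim_add x y : colim := sval (cid (colim_add_exists x y)).

Lemma colim_add_inj i (a b : G i) : colim_add (inj a) (inj b) = inj (a + b).
Proof.
rewrite /colim_add; case: cid => _ /= [j [c [d [ac bd ->]]]].
have [k [hi [hj [e f]]]] := inj_eq2 ac bd.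
by apply/inj_eq; exists k, hj, hi; rewrite !pog_funD e f.
Qed.

Lemma colim_zero_exists : exists z : colim, forall i, inj (0 : G i) = z.
Proof.
have [i0] := dset_inhabited I; exists (inj (0 : G i0)) => i.
have [k [h h0]] := dset_directed i i0.
by apply/inj_eq; exists k, h, h0; rewrite !pog_fun0.
Qed.

Definition colim_zero : colim := sval (cid colim_zero_exists).

Lemma colim_zero_inj i : inj (0 : G i) = colim_zero.
Proof. exact: (svalP (cid colim_zero_exists)). Qed.

Definition colim_opp : colim -> colim := desc (fun i (a : G i) => inj (- a)).

Lemma colim_opp_inj i (a : G i) : colim_opp (inj a) = inj (- a).
Proof.
by apply: desc_inj => {}i j h {}a; rewrite -pog_funN inj_phi.
Qed.

Lemma colim_addA : associative colim_add.
Proof.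
move=> x y z; have [i [a [b [c [-> -> ->]]]]] := colim_ind3 x y z.
by rewrite !colim_add_inj addrA.
Qed.

Lemma colim_addC : commutative colim_add.
Proof.
move=> x y; have [i [a [b [-> ->]]]] := colim_ind2 x y.
by rewrite !colim_add_inj addrC.
Qed.

Lemma colim_add0 : left_id colim_zero colim_add.
Proof.
move=> x; have [i [a ->]] := colim_ind1 x.
by rewrite -(colim_zero_inj i) colim_add_inj add0r.
Qed.

Lemma colim_addN : left_inverse colim_zero colim_opp colim_add.
Proof.
move=> x; have [i [a ->]] := colim_ind1 x.
by rewrite colim_opp_inj colim_add_inj addNr colim_zero_inj.
Qed.

HB.instance Definition _ :=
  GRing.isZmodule.Build colim colim_addA colim_addC colim_add0 colim_addN.

Lemma injD i (a b : G i) : inj (a + b) = inj a + inj b.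
Proof. by rewrite -colim_add_inj. Qed.

Lemma inj0 i : inj (0 : G i) = 0.
Proof. exact: colim_zero_inj. Qed.

Definition colim_act (c : Gamma) : colim -> colim :=
  desc (fun i (a : G i) => inj (gact c a)).

Lemma colim_act_inj c i (a : G i) : colim_act c (inj a) = inj (gact c a).
Proof.
by apply: desc_inj => {}i j h {}a; rewrite -pog_fun_act inj_phi.
Qed.

Definition colim_gammaGroup : gammaGroup Gamma.
Proof.
apply: (@GammaGroup Gamma colim colim_act) => [x|c d x|c x y].
- by have [i [a ->]] := colim_ind1 x; rewrite colim_act_inj gact1.
- by have [i [a ->]] := colim_ind1 x; rewrite !colim_act_inj gactM.
- have [i [a [b [-> ->]]]] := colim_ind2 x y.
  by rewrite -injD !colim_act_inj gactD injD.
Defined.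

Definition colim_ge (x y : colim) : Prop :=
  exists i (a b : G i), [/\ x = inj a, y = inj b & pge a b].

(** The witness of an inequality in the limit may lie at a stage unrelated to
    [i]; a stage above both where the representatives agree gives one above
    [i]. *)
Lemma colim_ge_inj i (a b : G i) :
  colim_ge (inj a) (inj b) <->
  exists j (h : dle i j), pge (phi h a) (phi h b).
Proof.
split=> [[j [c [d [ac bd cd]]]]|[j [h ab]]]; last first.
  by exists j, (phi h a), (phi h b); rewrite !inj_phi.
have [k [hi [hj [e f]]]] := inj_eq2 ac bd.
by exists k, hi; rewrite e f; exact: pog_fun_ge.
Qed.

(** Two inequalities hold at one common later stage; transitivity, antisymmetry
    and convexity each combine two inequalities and reduce to this. *)
Lemma colim_ge_inj2 i (a b c d : G i) :
  colim_ge (inj a) (inj b) -> colim_ge (inj c) (inj d) ->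
  exists j (h : dle i j),
    pge (phi h a) (phi h b) /\ pge (phi h c) (phi h d).
Proof.
move=> /colim_ge_inj[j [hj ab]] /colim_ge_inj[k [hk cd]].
have [l [hjl hkl]] := dset_directed j k; exists l, (dle_trans hj hjl); split.
  by rewrite -!(phi_comp hj hjl); exact: pog_fun_ge.
by rewrite -!(phi_comp hk hkl); exact: pog_fun_ge.
Qed.

Definition colim_pog : preorderedGroup Gamma.
Proof.
apply: (@PreorderedGroup Gamma colim_gammaGroup colim_ge)
  => [x|x y z|x y z|c x y].
- have [i [a ->]] := colim_ind1 x; exists i, a, a; split=> //; exact: pge_refl.
- have [i [a [b [c [-> -> ->]]]]] := colim_ind3 x y z.
  move=> xy /(colim_ge_inj2 xy)[j [h [ab bc]]].
  by apply/colim_ge_inj; exists j, h; exact: pge_trans bc.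
- have [i [a [b [c [-> -> ->]]]]] := colim_ind3 x y z.
  move=> /colim_ge_inj[j [h ab]]; rewrite -!injD.
  by apply/colim_ge_inj; exists j, h; rewrite !pog_funD; exact: pge_add.
- have [i [a [b [-> ->]]]] := colim_ind2 x y.
  move=> /colim_ge_inj[j [h ab]]; rewrite /= !colim_act_inj.
  by apply/colim_ge_inj; exists j, h; rewrite !pog_fun_act; exact: pge_act.
Defined.

Definition colim_inj i : pog_hom (G i) colim_pog.
Proof.
apply: (@PogHom Gamma (G i) colim_pog (@inj i)) => [a b|c a|a a0].
- exact: injD.
- by rewrite /= colim_act_inj.
- by exists i, a, 0; rewrite inj0.
Defined.

Lemma colim_is_ordered : (forall i, is_ordered (G i)) -> is_ordered colim_pog.
Proof.
move=> oG x y; have [i [a [b [-> ->]]]] := colim_ind2 x y.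
move=> xy /(colim_ge_inj2 xy)[j [h [ab ba]]].
by apply/inj_eq; exists j, h, h; exact: oG.
Qed.

Section UniversalProperty.
Variables (H : preorderedGroup Gamma) (f : forall i, pog_hom (G i) H).
Hypothesis f_compat : forall i j (h : dle i j) a, f j (phi h a) = f i a.

Let f_desc i (a : G i) : desc (fun i => f i) (inj a) = f i a.
Proof. exact: desc_inj. Qed.

Definition colim_desc : pog_hom colim_pog H.
Proof.
apply: (@PogHom Gamma colim_pog H (desc (fun i => f i))) => [x y|c x|x].
- have [i [a [b [-> ->]]]] := colim_ind2 x y.
  by rewrite -injD !f_desc pog_funD.
- have [i [a ->]] := colim_ind1 x.
  by rewrite /= colim_act_inj !f_desc pog_fun_act.
- have [i [a ->]] := colim_ind1 x.
  rewrite /pos_cone /= -(inj0 i) => /colim_ge_inj[j [h]].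
  by rewrite pog_fun0 f_desc -(f_compat h) => /(pog_fun_cone (f j)).
Defined.

Lemma colim_desc_inj i (a : G i) : colim_desc (colim_inj i a) = f i a.
Proof. exact: f_desc. Qed.

End UniversalProperty.

(** The same [c] that bounds [a] by [c u_i] at stage [i] bounds the image of [a]
    in the limit, since the injections commute with the group-ring action. *)
Lemma colim_order_unit (u : forall i, G i) :
  (forall i j (h : dle i j), phi h (u i) = u j) ->
  (forall i, order_unit (u i)) ->
  exists2 v : colim_pog, order_unit v & forall i, colim_inj i (u i) = v.
Proof.
move=> uE hu; have [i0] := dset_inhabited I.
have injuE i : colim_inj i (u i) = colim_inj i0 (u i0).
  have [k [h h0]] := dset_directed i i0.
  by rewrite /= -(inj_phi h) -(inj_phi h0) !uE.
exists (colim_inj i0 (u i0)) => //; split.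
  by apply: (pog_fun_cone (colim_inj i0)); have [] := hu i0.
move=> x; have [i [a ->]] := colim_ind1 x.
have [_ /(_ a)[c [c0 cN0 cua]]] := hu i; exists c; split=> //.
by rewrite -(injuE i) -pog_fun_zact; exact: (pog_fun_ge (colim_inj i)).
Qed.

(** Morphisms of the system map intervals into intervals, so finitely many
    elements of the union of the images come from a single [D k]; directedness,
    convexity and generation are then inherited from a late enough stage. *)
Lemma colim_generating_interval (D : forall i, set (G i)) :
  (forall i j (h : dle i j) a, D i a -> D j (phi h a)) ->
  (forall i, generating_interval (D i)) ->
  @generating_interval _ colim_pog
    [set x | exists i (a : G i), D i a /\ x = colim_inj i a].
Proof.
move=> phiD hD; split.
- move=> _ [i [a [Da ->]]]; apply: (pog_fun_cone (colim_inj i)).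
  by have [+ _ _ _ _] := hD i; apply.
- have [i] := dset_inhabited I; exists i, 0; rewrite /= inj0.
  by have [] := hD i.
- move=> _ _ [i [a [Da ->]]] [j [b [Db ->]]].
  have [k [hi hj]] := dset_directed i j.
  have [_ _ /(_ _ _ (phiD _ _ hi _ Da) (phiD _ _ hj _ Db)) + _ _] := hD k.
  move=> [c [Dc ca cb]]; exists (colim_inj k c); split; first by exists k, c.
    by rewrite /= -(inj_phi hi); exact: (pog_fun_ge (colim_inj k)).
  by rewrite /= -(inj_phi hj); exact: (pog_fun_ge (colim_inj k)).
- move=> _ z _ [i [a [Da ->]]] [j [b [Db ->]]].
  have [k [hi hj]] := dset_directed i j.
  rewrite /= -(inj_phi hi) -(inj_phi hj).
  move: {Da Db} (phi hi a) (phi hj b) (phiD _ _ hi _ Da) (phiD _ _ hj _ Db).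
  move=> {i j hi hj} {}a {}b Da Db.
  (* [z] may come from outside stage [k], and its representative lies in the
     interval only at a stage where both inequalities hold. *)
  have [l [c ->]] := colim_ind1 z; have [m [hk hl]] := dset_directed k l.
  rewrite -(inj_phi hk a) -(inj_phi hk b) -(inj_phi hl c).
  move=> ca /(colim_ge_inj2 ca)[n [h [{}ca bc]]].
  exists n, (phi h (phi hl c)); split; last by rewrite /= !inj_phi.
  have [_ _ _ conv _] := hD n.
  by apply: conv ca bc; do 2!apply: (phiD _ _ _ _).
- move=> x; have [i [a ->]] := colim_ind1 x.
  rewrite /pos_cone /= -{1}(inj0 i) => /colim_ge_inj[j [h]].
  rewrite pog_fun0 => a0; have [_ _ _ _ /(_ _ a0)[s [sD sE]]] := hD j.
  exists [seq (p.1, colim_inj j p.2) | p <- s]; split.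
    move=> _ /mapP[p /sD[p1 p2] ->]; split=> //.
    by exists j, p.2.
  rewrite -(inj_phi h) sE big_map; rewrite -[LHS]/(colim_inj j _) pog_fun_sum.
  by apply: eq_bigr => p _; exact: (pog_fun_zact (colim_inj j)).
Qed.

End Colimit.

(** * The six categories *)

Section Categories.
Variable Gamma : groupType.

(** The category [POG Gamma] hides its objects and morphisms behind [category];
    the families below present a system at the types [preorderedGroup] and
    [pog_hom] used by the construction. *)
Section PogLimit.
Variables (I : directed_set) (S : directed_system (POG Gamma) I).

Definition pog_system_obj (i : I) : preorderedGroup Gamma := S i.
Definition pog_system_map i j (h : dle i j) :
  pog_hom (pog_system_obj i) (pog_system_obj j) := sys_map S h.

Lemma pog_system_map_id i (h : dle i i) x : pog_system_map h x = x.
Proof. by rewrite /pog_system_map sys_map_id. Qed.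

Lemma pog_system_map_comp i j k
    (hij : dle i j) (hjk : dle j k) (hik : dle i k) x :
  pog_system_map hjk (pog_system_map hij x) = pog_system_map hik x.
Proof. by rewrite /pog_system_map -(sys_map_comp S hij hjk hik). Qed.

Definition pog_limit : preorderedGroup Gamma :=
  colim_pog pog_system_map_id pog_system_map_comp.

Definition pog_limit_leg i : pog_hom (pog_system_obj i) pog_limit :=
  colim_inj pog_system_map_id pog_system_map_comp i.

Lemma pog_limit_leg_compat i j (h : dle i j) :
  @cat_comp (POG Gamma) _ _ _ (pog_limit_leg j) (sys_map S h) =
  pog_limit_leg i.
Proof.
apply: pog_hom_eq => a.
exact: (inj_phi pog_system_map_id pog_system_map_comp h).
Qed.

Definition pog_limit_cocone : cocone S :=
  @Cocone (POG Gamma) I S pog_limit pog_limit_leg pog_limit_leg_compat.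

Lemma pog_limitP (x : pog_limit) :
  exists i (a : pog_system_obj i), x = pog_limit_leg i a.
Proof. exact: colim_ind1. Qed.

Lemma pog_limit_is_direct_limit : is_direct_limit pog_limit_cocone.
Proof.
move=> K.
have KE i j (h : dle i j) (a : pog_system_obj i) :
    (leg K j : pog_hom _ _) (pog_system_map h a) = (leg K i : pog_hom _ _) a.
  by rewrite -(leg_compat K h).
exists (colim_desc pog_system_map_id pog_system_map_comp KE); split.
  by move=> i; apply: pog_hom_eq => a; exact: colim_desc_inj.
move=> g gE; apply: pog_hom_eq => x; have [i [a ->]] := pog_limitP x.
by rewrite [LHS]colim_desc_inj -gE.
Qed.

End PogLimit.

Lemma POG_limits : has_direct_limits_with (C := POG Gamma) (@is_ordered Gamma).
Proof.
move=> I S; exists (pog_limit_cocone S); split.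
  exact: pog_limit_is_direct_limit.
exact: colim_is_ordered.
Qed.

Lemma POGu_limits :
  has_direct_limits_with (C := POGu Gamma)
    (fun X => is_ordered (ug_group X)).
Proof.
move=> I S; pose S0 := underlying_system S.
have [v vP vE] : exists2 v : pog_limit S0, order_unit v &
    forall i, pog_limit_leg S0 i (ug_unit (S i)) = v.
  apply: (colim_order_unit (G := pog_system_obj S0)) => [i j h|i].
    exact: (svalP (sys_map S h)).
  exact: ug_unitP.
have [||L hL LE] := structured_direct_limit (X := UnitGroup vP)
  (pog_limit_is_direct_limit (S := S0)).
- exact: vE.
(* [v] comes from some stage because the index set is inhabited. *)
- by move=> Y f fE; have [i] := dset_inhabited I; rewrite /= -(vE i) -(fE i).
exists L; split=> // oS; rewrite LE; exact: colim_is_ordered.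
Qed.

Lemma POGD_limits :
  has_direct_limits_with (C := POGD Gamma)
    (fun X => is_ordered (ig_group X)).
Proof.
move=> I S; pose S0 := underlying_system S.
pose G := pog_system_obj S0; pose D i : set (G i) := @ig_set Gamma (S i).
have phiD i j (h : dle i j) (a : G i) : D i a -> D j (pog_system_map S0 h a).
  by move=> Da; apply: (svalP (sys_map S h)); exists a.
pose X := IntervalGroup (colim_generating_interval
  (pog_system_map_id (S := S0)) (pog_system_map_comp (S := S0)) phiD
  (fun i => ig_setP (S i))).
have [||L hL LE] := structured_direct_limit (X := X)
  (pog_limit_is_direct_limit (S := S0)).
- by move=> i _ [a Da <-]; exists i, a.
- move=> Y f fD _ [_ [i [a [Da ->]]] <-].
  by apply: (fD i); exists a.
exists L; split=> // oS; rewrite LE; exact: colim_is_ordered.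
Qed.

End Categories.

Theorem proposition4p1 (Gamma : groupType) :
  [/\ has_direct_limits (POG Gamma),
      has_direct_limits (POGu Gamma)
    & has_direct_limits (POGD Gamma)] /\
  [/\ has_direct_limits (OG Gamma),
      has_direct_limits (OGu Gamma)
    & has_direct_limits (OGD Gamma)] /\
  [/\ @stable_under_direct_limits (POG Gamma) (@is_ordered Gamma),
      @stable_under_direct_limits (POGu Gamma)
        (fun X => is_ordered (ug_group X))
    & @stable_under_direct_limits (POGD Gamma)
        (fun X => is_ordered (ig_group X))].
Proof.
split; last split; split.
- exact: has_direct_limits_withW (@POG_limits Gamma).
- exact: has_direct_limits_withW (@POGu_limits Gamma).
- exact: has_direct_limits_withW (@POGD_limits Gamma).
- exact: full_subcategory_limits (@POG_limits Gamma).
- exact: full_subcategory_limits (@POGu_limits Gamma).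
- exact: full_subcategory_limits (@POGD_limits Gamma).
- apply: stable_of_limits (@POG_limits Gamma) => G H f g.
  exact: is_ordered_retract.
- apply: stable_of_limits (@POGu_limits Gamma) => X Y f g gf.
  exact: (is_ordered_retract (f := sval f) (g := sval g) (congr1 sval gf)).
- apply: stable_of_limits (@POGD_limits Gamma) => X Y f g gf.
  exact: (is_ordered_retract (f := sval f) (g := sval g) (congr1 sval gf)).
Qed.
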